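(* Let $r \ge 2$ be an integer with $r \ne 3$, and let $m, n, s$ be positive integers with $n$ sufficiently large, $m < 2^{-6} r^{2} n$ and $s = 100 r^{2} m$. Let $G$ be an $n$-vertex graph with minimum degree $\delta(G) = \frac{n}{2} + 6r^{2}m$, and let $\chi : E(G) \to [r]$ be an edge-coloring. Suppose that every Hamilton cycle $H \subseteq G$ satisfies $d_{\chi}(H) < m$. Then there exist a color $k \in [r]$ and a partition $V(G) = V_1 \cup V_2 \cup \dots \cup V_r$ with \[ |V_k| = \frac{r+1}{2r}n \quad\text{and}\quad |V_i| = \frac{n}{2r} \ \text{ for all } i \ne k, \] such that: (i) the induced subgraph $G[V_k]$ is $(s,k)$-nearly monochromatic; (ii) for every $i \ne k$, the bipartite subgraph $G[V_i, V_k]$ is $(s,i)$-nearly monochromatic; (iii) the induced subgraph $G\left[\bigcup_{i \in [r]\setminus\{k\}} V_i\right]$ is $s$-nearly empty.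
   Context: Floor and ceiling signs are omitted where not essential (part sizes such as $\frac{n}{2r}$ are understood up to rounding). For $V_i, V_j \subseteq V(G)$, $G[V_i,V_j]$ denotes the bipartite subgraph of $G$ with vertex set $V_i \cup V_j$ and edge set $\{uv \in E(G): u \in V_i, v \in V_j\}$. For a color $k$, $\chi^{-1}(k) = \{e \in E(G) : \chi(e) = k\}$. A subgraph $F \subseteq G$ is $s$-nearly empty if it contains no matching of size $s$; it is $(s,k)$-nearly monochromatic if $F \setminus \chi^{-1}(k)$ (the edges of $F$ not of color $k$) contains no matching of size $s$. For a Hamilton cycle $H$ in $G$, its color-bias is $d_{\chi}(H) = \max_{i \in [r]} \left|\, |\chi^{-1}(i) \cap E(H)| - \frac{n}{r} \right|$. *)

(* Defs.v *)
From mathcomp Require Import all_boot all_order all_algebra.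

Set Implicit Arguments.
Unset Strict Implicit.
Unset Printing Implicit Defensive.

Import Order.TTheory GRing.Theory Num.Theory.

Local Open Scope ring_scope.

(* [k] is [x] up to an omitted floor or ceiling sign. *)
Definition rounds_to (k : nat) (x : rat) : bool :=
  (k%:Z == Num.floor x) || (k%:Z == Num.ceil x).

Record sgraph (V : finType) := SGraph {
  adj : rel V;
  adj_sym : symmetric adj;
  adj_irr : irreflexive adj
}.

(* Edges are two-element sets of vertices.  Subgraphs are represented by their
   edge sets: matchings and color counts do not depend on the vertex set. *)
Section Graph.

Variables (V : finType) (G : sgraph V).

Definition edges : {set {set V}} :=
  [set [set u; v] | u in [set: V], v in [set: V] & adj G u v].

Definition degree (v : V) : nat := #|[set w | adj G v w]|.

(* Every degree is smaller than #|V|, so the default value #|V| is only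
   reached when V is empty. *)
Definition min_degree : nat := \big[minn/#|V|]_(v : V) degree v.

Definition induced_edges (A : {set V}) : {set {set V}} :=
  [set e in edges | e \subset A].

Definition bipartite_edges (A B : {set V}) : {set {set V}} :=
  [set [set u; v] | u in A, v in B & adj G u v].

Definition cycle_edges (c : seq V) : {set {set V}} :=
  [set [set x; next c x] | x in c].

Definition hamilton_cycle (H : {set {set V}}) : Prop :=
  exists c : seq V,
    [/\ ucycle (adj G) c, (2 < size c)%N, forall x : V, x \in c
      & H = cycle_edges c].

End Graph.

Section Matching.

Variable V : finType.
Implicit Types M F : {set {set V}}.

Definition matching M F : bool := (M \subset F) && trivIset M.

Definition nearly_empty (s : nat) F : Prop :=
  ~ exists M, matching M F /\ #|M| = s.

End Matching.

(* An edge-coloring of G is given by a function on all sets of vertices; only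
   its values on the edges of G are ever used. *)
Section Coloring.

Variables (V : finType) (G : sgraph V) (r : nat) (chi : {set V} -> 'I_r).

Definition color_class (i : 'I_r) : {set {set V}} :=
  [set e in edges G | chi e == i].

Definition nearly_mono (s : nat) (k : 'I_r) (F : {set {set V}}) : Prop :=
  nearly_empty s (F :\: color_class k).

(* The default value 0 of the maximum is harmless: all terms are
   nonnegative. *)
Definition color_bias (H : {set {set V}}) : rat :=
  \big[Num.max/0]_(i < r) `| #|color_class i :&: H|%:R - #|V|%:R / r%:R |.

End Coloring.

(* Main.v *)
Require Import Defs.
From mathcomp Require Import all_boot all_order all_algebra.
From mathcomp Require Import zify ring lra.

(* Suppose that [bc] and [de] are disjoint edges in the neighbourhood of [a].
   Moving [a] from between [b] and [c] to between [d] and [e] turns a Hamilton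
   cycle into another one, and changes the number of edges of colour [i] by
   h_i(a; d, e) - h_i(a; b, c), where h_i(a; x, y) = [ax = i] + [ay = i] - [xy = i].
   If 2m vertex-disjoint such bowties had a nonzero change for the same colour,
   in the same direction, then Dirac's argument would give a Hamilton cycle of
   the graph without their centres through all the edges [bc] and [de], and
   inserting the centres in the two possible ways would contradict the bias
   bound.  Hence a set [W] of O(r m) vertices meets all bowties with nonzero
   change.  Off [W], h_i(a; b, c) depends only on [a], and the parity of the
   number of edges of colour [i] in a triangle is constant.  Either three colours
   are odd, and then only these occur off [W], which the bias excludes as [r] is
   not 3; or a single colour [k] is odd, and then the vertices off [W] can be
   labelled so that every edge has an end labelled [k] and the colour of its
   other label.  Counting colours along one Hamilton cycle determines the sizes
   of the label classes up to O(r m). *)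

Import Order.TTheory GRing.Theory Num.Theory.

(** * Cyclic weights and Hamilton cycles *)

Section CyclicWeight.

Context {V : eqType}.
Implicit Types (w : V -> V -> nat) (c s : seq V).

(** One functional on cyclic orders counts missing edges ([nonadj]), occurrences of a given pair
    ([pairw]) and edges of a colour ([colw]), so each exchange is computed once for all three. *)
Fixpoint pathw w x s : nat :=
  if s is y :: s' then w x y + pathw w y s' else 0.

Definition cyclew w c : nat := if c is x :: s then pathw w x (rcons s x) else 0.

Lemma pathw_cat w x s1 s2 :
  pathw w x (s1 ++ s2) = pathw w x s1 + pathw w (last x s1) s2.
Proof. by elim: s1 x => //= y s1 IH x; rewrite IH addnA. Qed.

Lemma pathw_rcons w x s y : pathw w x (rcons s y) = pathw w x s + w (last x s) y.
Proof. by rewrite -cats1 pathw_cat /= addn0. Qed.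

Lemma pathw_rev w (wC : forall x y, w x y = w y x) x y s :
  pathw w x (rcons (rev s) y) = pathw w y (rcons s x).
Proof.
elim: s x y => [|z s IH] x y; first by rewrite /= wC.
by rewrite rev_cons pathw_rcons IH last_rcons /= addnC (wC z).
Qed.

Lemma cyclew_cons w x s : cyclew w (x :: s) = pathw w x s + w (last x s) x.
Proof. exact: pathw_rcons. Qed.

Lemma cyclew_catC w s1 s2 : cyclew w (s1 ++ s2) = cyclew w (s2 ++ s1).
Proof.
case: s1 => [|x s1]; first by rewrite cats0.
case: s2 => [|y s2]; first by rewrite cats0.
rewrite [LHS]cyclew_cons [RHS]cyclew_cons !pathw_cat !last_cat /=.
lia.
Qed.

Lemma cyclew_ge w s1 x y s2 : w x y <= cyclew w (s1 ++ x :: y :: s2).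
Proof. by rewrite cyclew_catC cyclew_cons /=; lia. Qed.

Lemma cyclew_insert w a x s :
  cyclew w (a :: x :: s) + w (last x s) x =
  cyclew w (x :: s) + w a x + w (last x s) a.
Proof. by rewrite !cyclew_cons /=; lia. Qed.

(** Reversing the segment [z :: s2] keeps its inner weight by symmetry, so only the two bounding
    pairs change. Written additively, as subtraction on [nat] is truncated. *)
Lemma cyclew_rotate w (wC : forall x y, w x y = w y x) x s1 z s2 :
  cyclew w (x :: s1 ++ rev (z :: s2)) + w (last x s1) z + w (last z s2) x =
  cyclew w (x :: s1 ++ z :: s2) + w (last x s1) (last z s2) + w z x.
Proof.
have -> : rev (z :: s2) = last z s2 :: behead (rev (z :: s2)).
  by case/lastP: s2 => [|s2 y] //; rewrite last_rcons -rcons_cons rev_rcons.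
rewrite !cyclew_cons !pathw_cat !last_cat /=.
have <- : pathw w (last z s2) (behead (rev (z :: s2))) = pathw w z s2.
  case/lastP: s2 => [|s2 y] //=.
  by rewrite last_rcons -rcons_cons rev_rcons /= rev_cons pathw_rev.
have -> : last (last z s2) (behead (rev (z :: s2))) = z.
  case/lastP: s2 => [|s2 y] //=.
  by rewrite last_rcons -rcons_cons rev_rcons /= rev_cons last_rcons.
lia.
Qed.

(** Agreement of all weights stands in for being the same cyclic order up to rotation. *)
Definition cyceq c c' := perm_eq c c' /\ forall w, cyclew w c = cyclew w c'.

Lemma pathw_gt0 w x s : 0 < pathw w x s ->
  exists s1 z s2, s = s1 ++ z :: s2 /\ 0 < w (last x s1) z.
Proof.
elim: s x => //= y s IH x; case: (posnP (w x y)) => [->|wxy _].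
  by case/IH=> s1 [z [s2 [-> wz]]]; exists (y :: s1), z, s2.
by exists [::], y, s.
Qed.

(** Rotates a pair of positive weight to the closing position, where exchanges and insertions are
    easy to express. *)
Lemma cyclew_gt0 w c : 0 < cyclew w c ->
  exists x s, cyceq (x :: s) c /\ 0 < w (last x s) x.
Proof.
case: c => //= x s /pathw_gt0[s1 [z [s2 []]]].
case/lastP: s2 => [|s2 y].
  rewrite cats1 => /rcons_inj[-> ->] wz; exists z, s1; split => //; split=> //.
rewrite -rcons_cons -rcons_cat => /rcons_inj[-> ->] wz.
exists z, (s2 ++ y :: s1); split; last by rewrite last_cat.
split=> [|w']; first by rewrite -!cat_cons perm_catC.
by rewrite -!cat_cons cyclew_catC.
Qed.

Lemma cyclew_next w c : uniq c -> cyclew w c = \sum_(x <- c) w x (next c x).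
Proof.
case: c => [|y p]; first by rewrite big_nil.
rewrite /next /cyclew; move: {3 5}y => y0.
elim: p y => [|y' p IH] y.
  by rewrite /= big_seq1 eqxx addn0.
rewrite cons_uniq => /andP[yN up] /=.
rewrite big_cons eqxx IH //; congr addn.
rewrite big_seq [RHS]big_seq; apply: eq_bigr => x xp.
by case: eqP => // xy; rewrite -xy xp in yN.
Qed.

Definition pairw (p : V * V) x y : nat := ((x, y) == p) || ((y, x) == p).

Lemma pairwC p x y : pairw p x y = pairw p y x.
Proof. by rewrite /pairw orbC. Qed.

Variable e : rel V.
Hypotheses (eC : symmetric e).

Definition nonadj x y : nat := ~~ e x y.

Lemma cyclew_cycle c : (cyclew nonadj c == 0) = cycle e c.
Proof.
case: c => //= x s; move: {2 4}x => x0.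
by elim: s x => [|y s IH] x /=; rewrite addn_eq0 eqb0 negbK ?IH ?andbT.
Qed.

(** Pigeonhole over the [size s] consecutive pairs of [y :: s]: without such a pair each one
    contributes at most 1, or 2 if it starts in [Q], to the right-hand side. *)
Lemma crossing (A B Q : pred V) y s :
    size s + count Q (belast y s) < count A s + count B (belast y s) ->
  exists s1 z s2, [/\ s = s1 ++ z :: s2, A z, B (last y s1) & ~~ Q (last y s1)].
Proof.
elim: s y => //= z s IH y H.
case ABQ: [&& A z, B y & ~~ Q y]; first by case/and3P: ABQ; exists [::], z, s.
case: (IH z) => [|s1 [z1 [s2 [-> ? ? ?]]]]; last by exists (z :: s1), z1, s2.
by case: (A z) (B y) (Q y) ABQ H => [] [] [] //=; lia.
Qed.

(* Dirac's argument: a cyclic order minimising the number of non-adjacent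
   consecutive pairs has none, since any such pair can be removed by a crossing
   exchange; enough crossings are available to avoid the pairs starting in [Q]. *)
Lemma protected_hamilton (eI : irreflexive e) (Q : pred V) (F : seq (V * V)) c :
    uniq c -> (forall u, u \in c -> size c + count Q c <= (count (e u) c).*2) ->
    (forall p, p \in F -> [&& Q p.1, Q p.2, e p.1 p.2 & 0 < cyclew (pairw p) c]) ->
  exists c', [/\ perm_eq c' c, cycle e c' &
    forall p, p \in F -> 0 < cyclew (pairw p) c'].
Proof.
have [N] := ubnP (cyclew nonadj c); elim: N c => // N IH c ltN uc degc Fc.
have [c0|] := posnP (cyclew nonadj c).
  exists c; split=> //; first by rewrite -cyclew_cycle c0.
  by move=> p /Fc/and4P[].
case/cyclew_gt0=> x [s [[eqc wc] wx]].
have uxs : uniq (x :: s) by rewrite (perm_uniq eqc).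
set v := last x s in wx.
have vx : e v x = false by move: wx; rewrite /nonadj; case: (e v x).
have xc : x \in c by rewrite -(perm_mem eqc) mem_head.
have vc : v \in c by rewrite -(perm_mem eqc) mem_last.
have cntc a : count a c = count a (x :: s) by move/permP: eqc => ->.
have sz : size c = (size s).+1 by rewrite -(perm_size eqc).
(* [x] and [v] close the cycle without being adjacent. The crossing supplies new edges from [x] to
   [z] and from [v] to the predecessor of [z]. *)
have [|s1 [z [s2 [sE xz vs1 Qs1]]]] := @crossing (e x) (e v) Q x s.
  have dx := degc x xc; have dv := degc v vc.
  have cx : count (e x) c = count (e x) s by rewrite cntc /= eI.
  have cv : count (e v) c = count (e v) (belast x s).
    by rewrite cntc lastI -cats1 count_cat /= -/v eI !addn0.
  have cQ : count Q (belast x s) <= count Q c.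
    by rewrite cntc lastI -cats1 count_cat leq_addr.
  by lia.
have wE w (wC : forall x y, w x y = w y x) := cyclew_rotate w wC x s1 z s2.
have lv : last z s2 = v by rewrite /v sE last_cat.
have peq : perm_eq (x :: s1 ++ rev (z :: s2)) c.
  by rewrite -(permPr eqc) sE -!cat_cons perm_cat2l perm_rev.
case: (IH (x :: s1 ++ rev (z :: s2))).
- have := wE nonadj (fun x y => congr1 (fun b : bool => (~~ b : nat)) (eC x y)).
  rewrite -sE wc lv [nonadj _ v]/nonadj (eC _ v) vs1 [nonadj z x]/nonadj (eC z) xz.
  by move: ltN wx; clear; lia.
- by rewrite (perm_uniq peq).
- move=> u; rewrite (perm_mem peq) (perm_size peq) => uc'.
  by move/permP: (peq) => pe; rewrite !pe degc.
(* The exchange breaks only two pairs: one starts outside [Q], the other is not an edge, so neither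
   belongs to [F]. *)
- move=> p pF; have /and4P[Q1 Q2 e12 pc] := Fc p pF.
  rewrite Q1 Q2 e12 !andTb; have := wE _ (pairwC p); rewrite -sE wc lv.
  have -> : pairw p (last x s1) z = 0.
    apply/eqP; rewrite eqb0; apply/negP => /orP[] /eqP E; move: Q1 Q2; rewrite -E /=.
      by rewrite (negbTE Qs1).
    by rewrite (negbTE Qs1).
  have -> : pairw p v x = 0.
    apply/eqP; rewrite eqb0; apply/negP => /orP[] /eqP E; move: e12; rewrite -E /=.
      by rewrite vx.
    by rewrite eC vx.
  by rewrite !addn0 -addnA => ->; rewrite (leq_trans pc) ?leq_addr.
move=> c' [peq' cyc' Fc']; exists c'; split=> //.
exact: perm_trans peq' peq.
Qed.

(* Each triple [(a, (x, y))] of [L] asks for [a] to be inserted between the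
   consecutive vertices [x] and [y]. *)
Lemma cycle_insert (L : seq (V * (V * V))) c :
    uniq (flatten [seq [:: t.2.1; t.2.2] | t <- L]) ->
    (forall t, t \in L -> [&& e t.1 t.2.1, e t.1 t.2.2 & 0 < cyclew (pairw t.2) c]) ->
    cycle e c ->
  exists c', [/\ perm_eq c' ([seq t.1 | t <- L] ++ c), cycle e c' &
    forall w (wC : forall x y, w x y = w y x),
    cyclew w c' + \sum_(t <- L) w t.2.1 t.2.2 =
    cyclew w c + \sum_(t <- L) (w t.1 t.2.1 + w t.1 t.2.2)].
Proof.
elim: L c => [|[a [x y]] L IH] c.
  by exists c; split=> // w _; rewrite !big_nil.
rewrite /= !inE negb_or -!andbA => /and4P[xy xL yL uL] HL cc.
have /and3P[/= ax ay] := HL _ (mem_head _ _).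
case/cyclew_gt0=> x1 [s [[eqc wc] w1]].
have {}w1 : (last x1 s, x1) = (x, y) \/ (x1, last x1 s) = (x, y).
  by move: w1; rewrite /pairw; case: eqP => [|_]; case: eqP => [|_] //; tauto.
have eal : e (last x1 s) a && e a x1.
  by case: w1 => [[-> ->]|[-> ->]]; rewrite (eC _ a) ax ay.
have wl w (wC : forall x y, w x y = w y x) :
    [/\ w (last x1 s) x1 = w x y & w a x1 + w (last x1 s) a = w a x + w a y].
  case: w1 => [[-> ->]|[-> ->]]; first by rewrite addnC (wC x a).
  by rewrite (wC y x) (wC y a).
case: (IH (a :: x1 :: s)) => //.
(* Inserting [a] breaks only the pair of [x] and [y], which is disjoint from every pair still to be
   used. *)
- move=> t tL; have /and3P[e1 e2 pt] := HL t (mem_behead (s := _ :: _) tL).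
  rewrite e1 e2 !andTb.
  have := cyclew_insert (pairw t.2) a x1 s; rewrite wc (wl _ (pairwC _)).1.
  have -> : pairw t.2 x y = 0; last first.
    by rewrite addn0 -addnA => ->; rewrite (leq_trans pt) ?leq_addr.
  apply/eqP; rewrite eqb0; apply/negP => /orP[] /eqP E.
    case/flattenP: xL; exists [:: t.2.1; t.2.2]; first exact: map_f.
    by rewrite -E mem_head.
  case/flattenP: yL; exists [:: t.2.1; t.2.2]; first exact: map_f.
  by rewrite -E mem_head.
- move: cc; rewrite -!cyclew_cycle -wc => /eqP c0.
  case/andP: eal => la a1.
  have := cyclew_insert nonadj a x1 s; rewrite c0.
  by rewrite {3 4}/nonadj la a1 !addn0 => /eqP; rewrite addn_eq0 => /andP[].
move=> c' [peq cyc' wc']; exists c'; split=> //.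
  apply: perm_trans peq _; rewrite -cat1s perm_catCA /= perm_cons perm_cat2l //.
move=> w wC; rewrite !big_cons /=; have := wc' w wC.
have := cyclew_insert w a x1 s; rewrite wc; have [-> ] := wl w wC.
by clear; lia.
Qed.

End CyclicWeight.

(** * Bowties *)

(** Greedy choice: when no further disjoint list fits, the vertices used so far meet every
    admissible list. *)
Lemma disjoint_or_hitting (T V : finType) (P : pred T) (vs : T -> seq V) d N :
    (forall t, P t -> uniq (vs t) && (size (vs t) <= d)) ->
  (exists ts, [/\ size ts = N, all P ts & uniq (flatten [seq vs t | t <- ts])])
  \/ exists2 W : {set V}, #|W| <= d * N & forall t, P t -> has [in W] (vs t).
Proof.
move=> Pvs; elim: N => [|N [[ts [sts Pts uts]]|[W cW HW]]]; first by left; exists [::].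
- pose W := [set x in flatten [seq vs t | t <- ts]].
  case: (pickP (fun t => P t && ~~ has [in W] (vs t))) => [t /andP[Pt Wt]|noP].
    left; exists (t :: ts); rewrite /= sts Pt Pts cat_uniq uts andbT.
    have /andP[-> _] := Pvs t Pt; split=> //=; rewrite andbT.
    apply: contraNN Wt => /hasP[x xf xt]; apply/hasP; exists x => //=.
    by rewrite inE.
  right; exists W => [|t Pt]; last by have := noP t; rewrite Pt => /negbFE.
  rewrite cardsE (leq_trans (card_size _)) // size_flatten /shape -map_comp.
  rewrite -sts mulnS; apply: leq_trans (leq_addl _ _) => {sts W noP uts}.
  elim: ts Pts => //= t ts IH /andP[Pt /IH H].
  by have /andP[_] := Pvs t Pt; rewrite mulnS; lia.
- by right; exists W => //; rewrite mulnS; lia.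
Qed.

Section Bowtie.

Context {V : finType}.
Variables (e : rel V) (w : V -> V -> nat).
Hypotheses (eC : symmetric e) (eI : irreflexive e).
Hypothesis wC : forall x y, w x y = w y x.

Let gadget : finType := (V * (V * V) * (V * V))%type.
Implicit Type g : gadget.

Definition wings g := [:: g.1.2.1; g.1.2.2; g.2.1; g.2.2].

(** The last conjunct is h(a; b, c) < h(a; d, e) with the negative terms moved across. Exchanging
    the wings reverses the inequality, so one sign suffices. *)
Definition bowtie g :=
  [&& uniq (g.1.1 :: wings g), all (e g.1.1) (wings g), e g.1.2.1 g.1.2.2,
      e g.2.1 g.2.2
    & w g.1.1 g.1.2.1 + w g.1.1 g.1.2.2 + w g.2.1 g.2.2
      < w g.1.1 g.2.1 + w g.1.1 g.2.2 + w g.1.2.1 g.1.2.2].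

(* A Hamilton cycle of the graph without the centres runs through both wings
   of every bowtie; each centre can be inserted in either of its two wings. *)
Lemma bowties_hamilton (gs : seq gadget) :
    all bowtie gs -> uniq (flatten [seq g.1.1 :: wings g | g <- gs]) ->
    (forall u, #|V| + 5 * size gs <= (count (e u) (enum V)).*2) ->
  exists c1 c2, [/\ perm_eq c1 (enum V), perm_eq c2 (enum V),
    cycle e c1, cycle e c2 & cyclew w c1 + size gs <= cyclew w c2].
Proof.
move=> /allP bgs ugs deg.
pose cs := [seq g.1.1 | g <- gs]; pose ws := flatten [seq wings g | g <- gs].
have pcw : perm_eq (flatten [seq g.1.1 :: wings g | g <- gs]) (cs ++ ws).
  rewrite /cs /ws; elim: (gs) => //= g s IH.
  rewrite perm_cons perm_sym (perm_catCA _ (wings g)) perm_cat2l perm_sym //.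
pose rest := [seq x <- enum V | x \notin cs ++ ws].
have ucw : uniq (cs ++ ws) by rewrite -(perm_uniq pcw).
have pall : perm_eq (cs ++ ws ++ rest) (enum V).
  rewrite catA; apply: uniq_perm; rewrite ?enum_uniq //.
    rewrite cat_uniq ucw filter_uniq ?enum_uniq // andbT.
    by apply/hasPn => x; rewrite mem_filter => /andP[].
  by move=> x; rewrite mem_cat mem_filter mem_enum andbT orbN.
have sz : size gs + size (ws ++ rest) = #|V|.
  by rewrite cardE -(perm_size pall) [RHS]size_cat size_map.
have cnt a : count a cs + count a (ws ++ rest) = count a (enum V).
  by move/permP: pall => <-; rewrite [RHS]count_cat.
have u0 : uniq (ws ++ rest).
  by have := perm_uniq pall; rewrite enum_uniq cat_uniq => /and3P[].
pose F := [seq g.1.2 | g <- gs] ++ [seq g.2 | g <- gs].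
have sws : size ws = 4 * size gs.
  by rewrite /ws; elim: (gs) => //= g s IH; rewrite IH; lia.
have inws g x : g \in gs -> x \in wings g -> x \in ws.
  by move=> gg xg; apply/flattenP; exists (wings g) => //; apply: map_f.
pose Q x := x \in ws.
(* Listing [ws] first makes every wing consecutive at the start. With N bowties, deleting the
   centres costs at most N in each degree d, and [Q] has 4N elements: n - N + 4N <= 2(d - N) is the
   bound n + 5N <= 2d. *)
case: (@protected_hamilton V e eC eI Q F (ws ++ rest) u0).
- move=> u _; rewrite (count_cat Q).
  have -> : count Q rest = 0.
    apply/eqP; rewrite -leqn0 leqNgt -has_count; apply/hasPn => x.
    by rewrite mem_filter mem_cat negb_or -andbA => /and3P[].
  have arith n N k l q a b c : N + k = n -> l = 4 * N -> q <= l -> n + 5 * N <= c.*2 ->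
    a <= N -> a + b = c -> k + (q + 0) <= b.*2 by lia.
  apply: arith sz sws (count_size _ _) (deg u) _ (cnt (e u)).
  by rewrite -(size_map (fun g => g.1.1)) count_size.
- have pos g : g \in gs -> 0 < cyclew (pairw g.1.2) (ws ++ rest) /\
                           0 < cyclew (pairw g.2) (ws ++ rest).
    move=> gg; have [l1 [l2 ->]] : exists l1 l2, ws = l1 ++ wings g ++ l2.
      rewrite /ws; case/splitPr: gg => s1 s2; rewrite map_cat flatten_cat.
      by exists (flatten (map wings s1)), (flatten (map wings s2)).
    rewrite /wings /= -catA /=; split.
      apply: leq_trans (cyclew_ge _ l1 _ _ _).
      by rewrite /pairw -surjective_pairing eqxx.
    rewrite -[g.1.2.1 :: _]/([:: g.1.2.1; g.1.2.2] ++ _) catA.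
    apply: leq_trans (cyclew_ge _ _ _ _ _).
    by rewrite /pairw -surjective_pairing eqxx.
  move=> p; rewrite mem_cat => /orP[] /mapP[g gg ->];
  have /and5P[_ _ b1 b2 _] := bgs g gg; have [p1 p2] := pos g gg;
  rewrite ?b1 ?b2 ?p1 ?p2 /Q !(inws g) // !inE eqxx ?orbT //.
move=> c0 [pc0 cyc0 Fc0].
(* [sel] chooses the wing that receives each centre. *)
have ins (sel : gadget -> V * V) :
    (forall g, g \in gs ->
      [/\ sel g \in F, (sel g).1 \in wings g & (sel g).2 \in wings g]) ->
    uniq (flatten [seq [:: (sel g).1; (sel g).2] | g <- gs]) ->
  exists c, [/\ perm_eq c (enum V), cycle e c &
    cyclew w c + \sum_(g <- gs) w (sel g).1 (sel g).2 =
    cyclew w c0 + \sum_(g <- gs) (w g.1.1 (sel g).1 + w g.1.1 (sel g).2)].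
  move=> selF us.
  case: (@cycle_insert V e eC [seq (g.1.1, sel g) | g <- gs] c0 _ _ cyc0).
  - by rewrite -map_comp.
  - move=> t /mapP[g gg ->] /=; have [gF g1 g2] := selF g gg.
    have /and5P[_ /allP ae _ _ _] := bgs g gg.
    by rewrite !ae // Fc0.
  move=> c [pc cyc wc]; exists c; split=> //.
    apply: perm_trans pc _; rewrite -map_comp; apply: perm_trans pall.
    by rewrite perm_cat2l.
  by have := wc w wC; rewrite !big_map.
have uws : uniq ws by move: ucw; rewrite cat_uniq => /and3P[].
have subu (sel : gadget -> V * V) :
    (forall g, subseq [:: (sel g).1; (sel g).2] (wings g)) ->
  uniq (flatten [seq [:: (sel g).1; (sel g).2] | g <- gs]).
  move=> sub; apply: subseq_uniq uws; rewrite /ws.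
  by elim: (gs) => // g s IH; apply: cat_subseq (sub g) IH.
case: (ins (fun g => g.1.2)).
- move=> g gg; rewrite !inE !eqxx !orbT; split=> //.
  by rewrite mem_cat (map_f (fun g : gadget => g.1.2)).
- by apply: subu => g; rewrite (prefix_subseq [:: _; _]).
move=> c1 [pc1 cyc1 w1]; case: (ins (fun g => g.2)).
- move=> g gg; rewrite !inE !eqxx !orbT; split=> //.
  by rewrite mem_cat (map_f (fun g : gadget => g.2)) ?orbT.
- by apply: subu => g; rewrite (suffix_subseq [:: _; _]).
move=> c2 [pc2 cyc2 w2]; exists c1, c2; split=> //.
(* Summing the strict inequalities gains at least one per bowtie; the weight of [c0] is common to
   both cycles. *)
have : \sum_(g <- gs) (w g.1.1 g.1.2.1 + w g.1.1 g.1.2.2) +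
       \sum_(g <- gs) w g.2.1 g.2.2 + size gs <=
       \sum_(g <- gs) (w g.1.1 g.2.1 + w g.1.1 g.2.2) +
       \sum_(g <- gs) w g.1.2.1 g.1.2.2.
  rewrite -!big_split -sum1_size -big_split /= big_seq [leqRHS]big_seq.
  by apply: leq_sum => g /bgs/and5P[_ _ _ _]; rewrite addn1.
have arith a b c d p q r k : p + a = r + b -> q + c = r + d ->
  b + c + k <= d + a -> p + k <= q by lia.
exact: arith w1 w2.
Qed.

End Bowtie.

(** * Colourings without bowties *)

Section Structure.

Context {V : finType} {r : nat}.
Variables (e : rel V) (col : V -> V -> 'I_r) (W : {set V}).
Hypotheses (eC : symmetric e) (eI : irreflexive e).
Hypothesis colC : forall x y, col x y = col y x.

Definition colw (i : 'I_r) x y : nat := col x y == i.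

Lemma colwC i x y : colw i x y = colw i y x.
Proof. by rewrite /colw colC. Qed.

Hypothesis common : forall u v (S : seq V), size S <= 4 ->
  exists x, [/\ e u x, e v x, x \notin W & x \notin S].
Hypothesis hit : forall i a b c x y, bowtie e (colw i) (a, (b, c), (x, y)) ->
  has [in W] [:: a; b; c; x; y].

Definition triangle a b c :=
  [&& a \notin W, b \notin W, c \notin W, e a b, e a c & e b c].

Lemma triangle_rot a b c : triangle a b c -> triangle b c a.
Proof.
case/and5P=> ? ? ? ? /andP[? ?]; rewrite /triangle !(eC _ a).
by apply/and5P; split=> //; apply/andP.
Qed.

Lemma edge_triangle a b : a \notin W -> b \notin W -> e a b ->
  exists c, triangle a b c.
Proof.
move=> aW bW ab; have [c [ac bc cW _]] := common a b [::] isT.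
by exists c; rewrite /triangle aW bW cW ab ac bc.
Qed.

(** A failure would make the two triangles a bowtie off [W], against [hit]. *)
Let weight_le a b c x y i : triangle a b c -> triangle a x y ->
    x \notin [:: b; c] -> y \notin [:: b; c] ->
  colw i a x + colw i a y + colw i b c <= colw i a b + colw i a c + colw i x y.
Proof.
move=> /and5P[aW bW cW ab /andP[ac bc]] /and5P[_ xW yW ax /andP[ay xy]].
rewrite !inE !negb_or => /andP[xb xc] /andP[yb yc].
rewrite leqNgt; apply/negP => lt.
have ne u v : e u v -> u != v by apply: contraTneq => ->; rewrite eI.
suff /hit : bowtie e (colw i) (a, (b, c), (x, y)).
  by rewrite /= (negbTE aW) (negbTE bW) (negbTE cW) (negbTE xW) (negbTE yW).
rewrite /bowtie /= !inE !negb_or ab ac ax ay bc xy lt.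
rewrite (ne _ _ ab) (ne _ _ ac) (ne _ _ ax) (ne _ _ ay) (ne _ _ bc) (ne _ _ xy).
by rewrite !(eq_sym b) !(eq_sym c) xb xc yb yc.
Qed.

(* That is, h_i(a; b, c) = 2 g_i(a) for a potential g_i on the vertices off [W],
   with [colw i u v] = g_i(u) + g_i(v) on all edges. *)
Lemma triangle_weight a b c x y i : triangle a b c -> triangle a x y ->
  colw i a b + colw i a c + colw i x y = colw i a x + colw i a y + colw i b c.
Proof.
move=> T1 T2.
(* The given triangles may overlap, so both are compared with a third one at [a] that avoids [b],
   [c], [x] and [y]. *)
have [z [az _ zW zS]] := common a a [:: b; c; x; y] isT.
have [t [at_ zt tW tS]] := common a z [:: b; c; x; y] isT.
have aW : a \notin W by case/andP: T1.
have T3 : triangle a z t by rewrite /triangle aW zW tW az at_ zt.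
move: zS tS; rewrite !inE !negb_or => /and4P[zb zc zx zy] /and4P[tb tc tx ty].
have := weight_le _ _ _ _ _ i T1 T3; have := weight_le _ _ _ _ _ i T3 T1.
have := weight_le _ _ _ _ _ i T2 T3; have := weight_le _ _ _ _ _ i T3 T2.
rewrite !inE !(eq_sym _ z) !(eq_sym _ t) !negb_or.
rewrite zb zc zx zy tb tc tx ty.
move=> /(_ isT isT) h1 /(_ isT isT) h2 /(_ isT isT) h3 /(_ isT isT) h4.
have arith k l m n u v : u + n <= m + v -> m + v <= u + n ->
  u + l <= k + v -> k + v <= u + l -> k + n = m + l by clear; lia.
exact: arith h2 h1 h4 h3.
Qed.

Definition oddtri i a b c := odd (colw i a b + colw i a c + colw i b c).

Lemma oddtri_rot i a b c : oddtri i a b c = oddtri i b c a.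
Proof. by rewrite /oddtri (colwC i c a) (colwC i b a) addnC addnA. Qed.

(** This is [triangle_weight] read modulo 2. *)
Lemma oddtri_vertex i a b c x y : triangle a b c -> triangle a x y ->
  oddtri i a b c = oddtri i a x y.
Proof.
move=> T1 T2; have := triangle_weight _ _ _ _ _ i T1 T2; rewrite /oddtri.
have arith k l m n : k + n = m + l -> odd (k + l) = odd (m + n) by clear; lia.
exact: arith.
Qed.

(** A common neighbour [t] of [a] and [x] links the two: triangles on the edges from [a] and [x] to
    [t] share the vertex [t]. *)
Lemma oddtri_const i a b c x y z : triangle a b c -> triangle x y z ->
  oddtri i a b c = oddtri i x y z.
Proof.
move=> T1 T2.
have [t [at_ xt tW _]] := common a x [::] isT.
have aW : a \notin W by case/andP: T1.
have xW : x \notin W by case/andP: T2.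
have [u Tu] := edge_triangle _ _ aW tW at_.
have [v Tv] := edge_triangle _ _ xW tW xt.
rewrite (oddtri_vertex i _ _ _ _ _ T1 Tu) (oddtri_vertex i _ _ _ _ _ T2 Tv).
rewrite !(oddtri_rot i _ t).
by apply: oddtri_vertex; apply: triangle_rot.
Qed.

Lemma coloring_structure (x0 : V) :
  (exists k f, forall u v, u \notin W -> v \notin W -> e u v ->
     (f u = k /\ col u v = f v) \/ (f v = k /\ col u v = f u))
  \/ (exists p q t, [/\ p != q, p != t, q != t & forall u v,
       u \notin W -> v \notin W -> e u v -> col u v \in [:: p; q; t]]).
Proof.
have [a0 [_ _ a0W _]] := common x0 x0 [::] isT.
have [b0 [ab0 _ b0W _]] := common a0 a0 [::] isT.
have [c0 T0] := edge_triangle _ _ a0W b0W ab0.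
pose p := col a0 b0; pose q := col a0 c0; pose t := col b0 c0.
case D: [&& p != q, p != t & q != t].
  right; exists p, q, t; have /and3P[pq pt qt] := D; split=> // u v uW vW uv.
  have [z Tz] := edge_triangle _ _ uW vW uv.
  have O i := oddtri_const i _ _ _ _ _ _ T0 Tz.
  have := O (col u v); have := O p; have := O q; have := O t.
  rewrite /oddtri /colw -/p -/q -/t !inE !eqxx.
  move: (col u v) (col u z) (col v z) => p' q' t'.
  move: pq pt qt; rewrite !(eq_sym q p) !(eq_sym t p) !(eq_sym t q).
  move=> /negbTE-> /negbTE-> /negbTE->; rewrite !(eq_sym _ p').
  case: (eqVneq p' p) => // pp; case: (eqVneq p' q) => // pq.
  case: (eqVneq p' t) => // pt.
  (* Were the colour of [uv] none of the three, the other two edges of the triangle would have to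
     carry three distinct colours. *)
  move=> Ot Oq Op _ /=; have [qt qq qp] :
      [/\ (q' == t) || (t' == t), (q' == q) || (t' == q) & (q' == p) || (t' == p)].
    by move: Ot Oq Op; do 6!case: eqP.
  by case/orP: qt => /eqP tE; case/orP: qq => /eqP qE; case/orP: qp => /eqP pE;
    move: D; rewrite -tE -qE -pE eqxx ?andbF.
left.
(* A triangle with two edges of equal colour has exactly one odd colour, that of its third edge. *)
have [k Ok] : exists k, forall a b c, triangle a b c ->
    forall i, oddtri i a b c = (i == k).
  suff [k Ok] : exists k, forall i, oddtri i a0 b0 c0 = (i == k).
    by exists k => a b c T i; rewrite -(Ok i); exact: oddtri_const.
  rewrite /oddtri /colw -/p -/q -/t; case: (eqVneq p q) D => /= [->|pq D].
    by exists t => i; rewrite addnn oddD odd_double (eq_sym t); case: eqP.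
  case: (eqVneq p t) D => /= [-> _|pt /negbFE/eqP ->].
    by exists q => i; rewrite addnAC addnn oddD odd_double (eq_sym q); case: eqP.
  by exists p => i; rewrite -addnA addnn oddD odd_double addbF (eq_sym p); case: eqP.
(* The label encodes the potential: h_i(a; b, c) = 2[f a = i] - [k = i]. In a triangle at [a], two
   equal colours at [a] give the label; otherwise one of them is [k], and so is the label. *)
have [f fP] : exists f : V -> 'I_r, forall a b c i, triangle a b c ->
    colw i a b + colw i a c + (k == i) = 2 * (f a == i) + colw i b c.
  pose f a := if [pick bc | triangle a bc.1 bc.2] is Some bc then
    if col a bc.1 == col a bc.2 then col a bc.1 else k else k.
  exists f => a b c i T; rewrite /f; case: pickP => [[x y] /= T'|/(_ (b, c))]; last first.
    by rewrite /= T.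
  have O := Ok _ _ _ T'; have E := triangle_weight _ _ _ _ _ i T T'.
  suff F : colw i a x + colw i a y + (k == i) =
     2 * ((if col a x == col a y then col a x else k) == i) + colw i x y.
    have arith A B C L K M : A + C = L + B -> L + K = M + C -> A + K = M + B.
      by clear; lia.
    exact: arith E F.
  move: O; rewrite /oddtri /colw; move: (col a x) (col a y) (col x y) => p' q' t' O.
  have := O p'; have := O q'; move: (O t'); rewrite !eqxx.
  case: (eqVneq p' q') => [<-|pq'].
    by rewrite addnn oddD odd_double mul2n => /esym/eqP-> _ _; rewrite addnn.
  case: (eqVneq t' p') => [->|tp].
    rewrite (eq_sym q') (negbTE pq') => _ /esym/eqP-> _.
    by rewrite mul2n -addnn addnAC addnC addnA.
  case: (eqVneq t' q') => [->|tq].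
    move=> _ _ /esym/eqP->.
    by rewrite mul2n -addnn addnAC.
  by move=> _ /esym/eqP qk /esym/eqP pk; rewrite pk qk eqxx in pq'.
exists k, f => u v uW vW uv; have [z T] := edge_triangle _ _ uW vW uv.
(* Adding the identities at [u] and [v] shows that their labels are, as a multiset, [k] and the
   colour of [uv]. *)
have E i : (f u == i) + (f v == i) = (col u v == i) + (k == i).
  have := fP _ _ _ i T; have := fP _ _ _ i (triangle_rot _ _ _ T).
  rewrite (colwC i v u) (colwC i z u) /colw => E1 E2.
  have arith A B C K L M : A + B + K = 2 * L + C -> C + A + K = 2 * M + B ->
    L + M = A + K by clear; lia.
  exact: arith E2 E1.
have := E k; rewrite eqxx; case: (eqVneq (f u) k) => [fu _|_].
  left; split=> //; have := E (f v); rewrite fu eqxx addnC.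
  by move=> /addIn/eqP; rewrite eq_sym eqb1 => /eqP.
case: (eqVneq (f v) k) => [fv _|_]; last by rewrite addn1.
right; split=> //; have := E (f u); rewrite fv eqxx.
by move=> /addIn/eqP; rewrite eq_sym eqb1 => /eqP.
Qed.

End Structure.

(** * Partitions, matchings and edge counts *)

(** Moving one vertex from an oversized class to an undersized one lowers the total deficit by
    one. *)
Lemma relabel_sizes (V : finType) (r : nat) (t : 'I_r -> nat) (f : V -> 'I_r) :
    \sum_i t i = #|V| ->
  exists f' : V -> 'I_r, (forall i, #|[set x | f' x == i]| = t i) /\
    #|[set x | f' x != f x]| <= \sum_i (t i - #|[set x | f x == i]|).
Proof.
move=> tV; have sumV g : \sum_i #|[set x : V | g x == i :> 'I_r]| = #|V|.
  rewrite -sum1_card (partition_big g xpredT) //=.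
  by apply: eq_bigr => i _; rewrite -sum1_card; apply: eq_bigl => x; rewrite inE.
move DN: (\sum_i _) => N; elim: N f DN => [|N IH] f DN.
  have le i : t i <= #|[set x | f x == i]|.
    by rewrite -subn_eq0; move/eqP: DN; rewrite sum_nat_eq0 => /forallP/(_ i).
  exists f; split=> [i|]; last first.
    rewrite leqn0 cards_eq0; apply/eqP/setP => x; by rewrite !inE; case: eqP.
  have /eqP := sumV f; rewrite -tV eq_sym => /eqP E.
  have := @leqif_sum _ xpredT (fun i => t i == #|[set x | f x == i]|) t _
    (fun i _ => leqif_eq (le i)).
  by case=> _; rewrite E eqxx => /esym/forallP/(_ i)/eqP.
have [i ti] : exists i, #|[set x | f x == i]| < t i.
  apply/existsP; apply: contra_eqT DN; rewrite negb_exists => /forallP H.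
  by rewrite big1 // => i _; apply/eqP; rewrite subn_eq0 leqNgt.
have [j tj] : exists j, t j < #|[set x | f x == j]|.
  apply/existsP; apply: contraLR ti; rewrite negb_exists => /forallP H.
  have le j : #|[set x | f x == j]| <= t j by rewrite leqNgt.
  have := @leqif_sum _ xpredT _ _ _ (fun i _ => leqif_eq (le i)).
  by case=> _; rewrite sumV tV eqxx => /esym/forallP/(_ i)/eqP->; rewrite ltnn.
have ij : i != j by apply: contraTneq ti => ->; rewrite -leqNgt ltnW.
have [x] : exists x, x \in [set x | f x == j] by apply/card_gt0P; case: #|_| tj.
rewrite inE => /eqP fx; pose g y := if y == x then i else f y.
have gi : [set y | g y == i] = x |: [set y | f y == i].
  by apply/setP => y; rewrite !inE /g; case: (eqVneq y x) => //= _; rewrite eqxx.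
have gj : [set y | g y == j] = [set y | f y == j] :\ x.
  by apply/setP => y; rewrite !inE /g; case: (eqVneq y x) => //= _; rewrite (negbTE ij).
have gl l : l != i -> l != j -> [set y | g y == l] = [set y | f y == l].
  move=> li lj; apply/setP => y; rewrite !inE /g; case: (eqVneq y x) => // ->.
  by rewrite fx eq_sym (negbTE li) eq_sym (negbTE lj).
have ci : #|[set y | g y == i]| = #|[set y | f y == i]|.+1.
  by rewrite gi cardsU1 inE fx eq_sym ij.
have cj : #|[set y | f y == j]| = #|[set y | g y == j]|.+1.
  by rewrite gj (cardsD1 x [set y | f y == j]) inE fx eqxx.
case: (IH g) => [|f' [f't f'g]].
  move: DN; rewrite (bigD1 i) //= (bigD1 j) 1?eq_sym //= => DN.
  rewrite (bigD1 i) //= (bigD1 j) 1?eq_sym //= ci.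
  rewrite (eq_bigr (fun l => t l - #|[set y | f y == l]|)); last first.
    by move=> l /andP[li lj]; rewrite gl.
  move: DN ti tj; rewrite cj; clear; lia.
exists f'; split=> //; apply: leq_trans (_ : #|x |: [set y | f' y != g y]| <= _).
  apply/subset_leq_card/subsetP => y; rewrite !inE /g.
  by case: (eqVneq y x).
by rewrite cardsU1; case: (_ \in _); move: f'g; clear; lia.
Qed.

Section Rounding.
Local Open Scope ring_scope.

Lemma rounds_to_divn a b : (0 < b)%N -> rounds_to (a %/ b) (a%:R / b%:R).
Proof.
move=> b0; apply/orP; left; rewrite eq_sym floor_eq.
have bR : (0 : rat) < b%:R by rewrite ltr0n.
rewrite ler_pdivlMr // ltr_pdivrMr // intrD -!pmulrn -natrD -!natrM.
by rewrite ler_nat ltr_nat leq_divM addn1 ltn_ceil.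
Qed.

Lemma rounds_to_divnS a b : (0 < b)%N -> (0 < a %% b)%N ->
  rounds_to (a %/ b).+1 (a%:R / b%:R).
Proof.
move=> b0 ab.
apply/orP; right; rewrite eq_sym ceil_eq.
have bR : (0 : rat) < b%:R by rewrite ltr0n.
rewrite ler_pdivrMr // ltr_pdivlMr // intrD -!pmulrn -natr1 addrK natr1 -!natrM.
rewrite ler_nat ltr_nat; apply/andP; split; last by rewrite ltnW ?ltn_ceil.
by rewrite [X in (_ < X)%N](divn_eq a b) -addn1 leq_add2l.
Qed.

Lemma rounds_to_gt k x : rounds_to k x -> x < k%:R + 1.
Proof.
rewrite /rounds_to => /orP[]; rewrite eq_sym ?floor_eq ?ceil_eq => /andP[].
  by rewrite intrD -!pmulrn.
by rewrite -!pmulrn => _ /le_lt_trans; apply; rewrite ltrDl ltr01.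
Qed.

End Rounding.

Section Matchings.

Context {V : finType}.
Implicit Types (F : {set {set V}}) (Z : {set V}).

(** Choosing a vertex of [Z] in each edge is injective on a matching. *)
Lemma nearly_empty_hit s F Z : #|Z| < s ->
  (forall A, A \in F -> ~~ [disjoint A & Z]) -> nearly_empty s F.
Proof.
move=> Zs FZ [M [/andP[/subsetP MF tM] cM]].
pose h (A : {set V}) := [pick x in A :&: Z].
have hP A : A \in M -> exists x, [/\ h A = Some x, x \in A & x \in Z].
  move=> /MF/FZ; rewrite -setI_eq0 /h => /set0Pn[x xAZ].
  by case: pickP => [y /setIP[]|/(_ x)]; [exists y | rewrite xAZ].
suff : #|M| <= #|Z| by rewrite cM leqNgt Zs.
rewrite -(@card_in_imset _ _ h (mem M)); last first.
  move=> A B AM BM hAB; have [x [hA xA _]] := hP A AM; have [y [hB yB _]] := hP B BM.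
  apply/eqP; apply: contraTT xA => AB.
  have /trivIsetP/(_ _ _ AM BM AB)/disjointFl -> // := tM.
  by move: hAB; rewrite hA hB => -[->].
rewrite -(@card_imset _ _ Some Z) //; last by move=> x y [].
apply/subset_leq_card/subsetP => _ /imsetP[A AM ->].
by have [x [-> _ xZ]] := hP A AM; apply: imset_f.
Qed.

(** A matching of size [s] covers [2 * s] vertices; this settles the case of few vertices. *)
Lemma nearly_empty_large s F :
  (forall A, A \in F -> #|A| = 2) -> #|V| < 2 * s -> nearly_empty s F.
Proof.
move=> F2 Vs [M [/andP[/subsetP MF /eqP tM] cM]].
have : #|cover M| <= #|V| by apply: max_card.
rewrite -tM (eq_bigr (fun _ => 2)) => [|A /MF/F2 //].
rewrite sum_nat_const cM; lia.
Qed.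

End Matchings.

Section CycleEdges.

Context {V : finType} {r : nat}.
Variables (G : sgraph V) (chi : {set V} -> 'I_r).

Definition edge_color x y : 'I_r := chi [set x; y].

Lemma edge_colorC x y : edge_color x y = edge_color y x.
Proof. by rewrite /edge_color setUC. Qed.

Lemma min_degree_le v : min_degree G <= degree G v.
Proof.
rewrite /min_degree; elim: (index_enum V) (mem_index_enum v) => //= u s IH.
by rewrite big_cons inE => /orP[/eqP->|/IH H]; rewrite geq_min ?leqnn ?H ?orbT.
Qed.

Lemma adj_edges u v : adj G u v -> [set u; v] \in edges G.
Proof. by move=> uv; apply/imset2P; exists u v; rewrite ?inE. Qed.

(** Beyond length 2, distinct positions of the cycle give distinct two-element sets, so counting
    edges agrees with counting consecutive pairs. *)
Lemma color_count c i : uniq c -> cycle (adj G) c -> 2 < size c ->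
  #|color_class G chi i :&: cycle_edges c| = cyclew (colw edge_color i) c.
Proof.
move=> uc cc sc.
have inj : {in c &, injective (fun x => [set x; next c x])}.
  move=> x y xc yc E; have : x \in [set y; next c y] by rewrite -E !inE eqxx.
  rewrite !inE => /orP[/eqP//|/eqP xy].
  have : y \in [set x; next c x] by rewrite E !inE eqxx.
  rewrite !inE => /orP[/eqP//|/eqP yx].
  have [j s Ec] := rot_to xc; move: yx xy sc; rewrite -!(next_rot j uc) -(size_rot j c).
  move: uc; rewrite -(rot_uniq j) Ec; case: s Ec => [|a [|b s]] // _.
  rewrite /= !inE !negb_or eqxx -!andbA => /and5P[xa xb _ _ _] <-.
  by case: eqVneq => [->|_] //; rewrite eqxx => bx; rewrite -bx eqxx in xb.
rewrite cyclew_next // big_uniq //.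
transitivity (\sum_(A in cycle_edges c) (chi A == i)); last by rewrite big_imset.
rewrite -sum1_card (eq_bigl (fun A => (A \in cycle_edges c) && (chi A == i))).
  by rewrite -big_mkcondr.
move=> A; rewrite in_setI inE andbC; case: imsetP => //= -[x xc ->].
by rewrite adj_edges ?(next_cycle cc).
Qed.

End CycleEdges.

(** * Label classes *)

Section CycleSums.

Context {V : eqType}.

Lemma cyclew_le (e : rel V) w w' c : (forall x y, e x y -> w x y <= w' x y) ->
  cycle e c -> cyclew w c <= cyclew w' c.
Proof.
move=> le; case: c => //= x s; move: (rcons s x) => l; elim: l x => //= z l IH x /andP[xz zl].
by rewrite leq_add ?le ?IH.
Qed.

Lemma cyclew_add (w w' : V -> V -> nat) c :
  cyclew (fun x y => w x y + w' x y) c = cyclew w c + cyclew w' c.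
Proof.
case: c => //= x s; move: (rcons s x) => l; elim: l x => //= z l IH x.
by rewrite IH addnACA.
Qed.

Lemma cyclew_vertex (F : V -> nat) c :
  cyclew (fun x y => F x + F y) c = (\sum_(x <- c) F x).*2.
Proof.
rewrite cyclew_add -addnn; congr addn; case: c => //= [|x s]; rewrite ?big_nil //.
  have H y : pathw (fun z _ => F z) x (rcons s y) = \sum_(z <- x :: s) F z.
    elim: s x => [|z s IH] x /=; first by rewrite big_seq1 addn0.
    by rewrite IH [RHS]big_cons.
  exact: H.
have <- : \sum_(y <- rcons s x) F y = \sum_(y <- x :: s) F y.
  by apply: perm_big; rewrite perm_rcons.
move: (rcons s x) => l; elim: l x => [|z l IH] x /=; first by rewrite big_nil.
by rewrite IH big_cons.
Qed.

End CycleSums.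

(** Write n = 2rq + p. Class [k] gets the floor (r + 1)q + g; each other class gets q, and p - g <=
    r - 1 of them get one more. The last clause is the rounding error in integer form. *)
Lemma part_sizes (r n : nat) (k : 'I_r) : 2 <= r ->
  exists t : 'I_r -> nat, [/\ \sum_i t i = n,
    rounds_to (t k) ((r%:R + 1) / (2%:R * r%:R) * n%:R)%R,
    (forall i, i != k -> rounds_to (t i) (n%:R / (2%:R * r%:R))%R)
  & forall i, i != k -> 2 * r * t i <= n + 2 * r /\ n <= 2 * r * t i + 2 * r].
Proof.
move=> r2; have d0 : 0 < 2 * r by lia.
have r0 : (r%:R != 0 :> rat)%R by rewrite pnatr_eq0; lia.
pose q := n %/ (2 * r); pose p := n %% (2 * r).
have nE : n = q * (2 * r) + p := divn_eq n (2 * r).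
have p_lt : p < 2 * r by rewrite ltn_mod.
pose g := ((r + 1) * p) %/ (2 * r).
have gE : (r + 1) * p = g * (2 * r) + ((r + 1) * p) %% (2 * r) := divn_eq _ _.
have h_lt : ((r + 1) * p) %% (2 * r) < 2 * r by rewrite ltn_mod.
have gp : g <= p.
  by rewrite /g -ltnS ltn_divLR //; move: (p) r2; clear; nia.
have pg : p - g <= r.-1.
  move: gE h_lt gp p_lt r2; clear; nia.
have tkE : ((r + 1) * n) %/ (2 * r) = (r + 1) * q + g.
  by rewrite {1}nE mulnDr mulnA divnMDl.
have [E [EK cE]] : exists E : {set 'I_r}, E \subset [set~ k] /\ #|E| = p - g.
  exists [set x in take (p - g) (enum [set~ k])]; split.
    apply/subsetP => x; rewrite inE => /mem_take; by rewrite mem_enum.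
  rewrite cardsE (card_uniqP _) ?take_uniq ?enum_uniq // size_take -cardE.
  rewrite cardsC1 card_ord.
  by case: ltnP => // ?; apply/eqP; rewrite eqn_leq; apply/andP.
exists (fun i => if i == k then (r + 1) * q + g else q + (i \in E)); split.
- rewrite (bigD1 k) //= eqxx (eq_bigr (fun i => q + (i \in E))); last first.
    by move=> i /negbTE->.
  rewrite big_split /= sum_nat_const -big_mkcondr /=.
  rewrite (eq_bigl (mem E)); last first.
    by move=> i /=; rewrite andb_idl // => /(subsetP EK); rewrite !inE.
  rewrite sum1_card cE cardC1 card_ord.
  by move: nE gp r2; clear; nia.
- rewrite eqxx -tkE.
  have -> : ((r%:R + 1) / (2%:R * r%:R) * n%:R)%R =
            (((r + 1) * n)%:R / (2 * r)%:R)%R :> rat.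
    by rewrite !natrM natrD; field.
  exact: rounds_to_divn.
- move=> i /negbTE ->; rewrite -natrM; case iE: (i \in E); last first.
    by rewrite addn0; apply: rounds_to_divn.
  rewrite addn1; apply: rounds_to_divnS => //; rewrite -/p lt0n.
  apply: contraTneq iE => p0.
  have : #|E| == 0 by rewrite cE p0.
  by rewrite cards_eq0 => /eqP->; rewrite inE.
- move=> i /negbTE ->; case: (i \in E); move: nE p_lt; clear; nia.
Qed.

(** * Consequences of the bias bound on Hamilton cycles *)

Section HamiltonBias.

Context {V : finType} {r : nat}.
Variables (G : sgraph V) (chi : {set V} -> 'I_r) (m : nat).

Let col := edge_color chi.
Let n := #|V|.

Hypotheses (r2 : 2 <= r) (m0 : 0 < m).
(** The minimum degree cleared of denominators; the 1 absorbs rounding. *)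
Hypothesis deg : forall u, n + 12 * (r ^ 2 * m) <= (degree G u).*2 + 1.
Hypothesis bias : forall c i, perm_eq c (enum V) -> cycle (adj G) c ->
  n < r * cyclew (colw col i) c + r * m /\ r * cyclew (colw col i) c < n + r * m.

Let rm : 2 <= r * m.
Proof. by move: r2 m0; clear; nia. Qed.
Let rrm : 2 * (r * m) <= r ^ 2 * m.
Proof. by move: r2; clear; nia. Qed.
Let mrm : 2 * m <= r * m.
Proof. by move: r2; clear; nia. Qed.

Lemma count_degree u : count (adj G u) (enum V) = degree G u.
Proof.
rewrite /degree cardE -size_filter /enum_mem; congr size.
by rewrite -filter_predI; apply: eq_filter => x; rewrite /= inE andbT.
Qed.

(** For one colour, 2m disjoint bowties give two Hamilton cycles whose counts differ by at least 2m,
    while the bias allows less. So 5 * 2m vertices per colour suffice. *)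
Lemma hitting_set : exists2 W : {set V}, #|W| <= 10 * (r * m) &
  forall i a b c x y, bowtie (adj G) (colw col i) (a, (b, c), (x, y)) ->
    has [in W] [:: a; b; c; x; y].
Proof.
have H i : exists W : {set V}, #|W| <= 5 * (2 * m) /\
    forall g, bowtie (adj G) (colw col i) g -> has [in W] (g.1.1 :: wings g).
  have [||[W cW HW]] := @disjoint_or_hitting _ V (bowtie (adj G) (colw col i))
    (fun g => g.1.1 :: wings g) 5 (2 * m); last by exists W.
  - by move=> g /and5P[-> _ _ _ _].
  case=> gs [sgs bgs ugs].
  have colC : forall x y, colw col i x y = colw col i y x.
    exact/colwC/edge_colorC.
  have [|c1 [c2 [p1 p2 h1 h2]]] :=
      bowties_hamilton _ _ (adj_sym G) (adj_irr G) colC gs bgs ugs.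
    move=> u; rewrite count_degree sgs; move: (deg u) rrm mrm rm; rewrite /n; clear; lia.
  have [b1 _] := bias c1 i p1 h1; have [_ b2] := bias c2 i p2 h2.
  rewrite sgs; move: b1 b2; rewrite /n; clear; nia.
have [F HF] := fin_all_exists H.
exists (\bigcup_i F i) => [|i a b c x y /(HF i).2/hasP[z zs zF]]; last first.
  by apply/hasP; exists z => //; apply/bigcupP; exists i.
have -> : 10 * (r * m) = \sum_(i < r) 5 * (2 * m).
  by rewrite sum_nat_const card_ord; clear; lia.
apply: (big_ind2 (fun (A : {set V}) b => #|A| <= b)) => [|A a B b Aa Bb|i _].
- by rewrite cards0.
- by rewrite (leq_trans (leq_card_setU _ _)) ?leq_add.
- exact: (HF i).1.
Qed.

(** The degrees force at least 12r^2m - 1 common neighbours, more than 10rm + 4. *)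
Lemma common_neighbour (W : {set V}) u v (S : seq V) :
    #|W| <= 10 * (r * m) -> size S <= 4 ->
  exists x, [/\ adj G u x, adj G v x, x \notin W & x \notin S].
Proof.
move=> cW sS; pose N z := [set w | adj G z w].
have [/existsP[x /and4P[]]|] := boolP
    [exists x, [&& adj G u x, adj G v x, x \notin W & x \notin S]].
  by exists x.
rewrite negb_exists => /forallP noX; exfalso.
have sub : #|N u :&: N v| <= #|W :|: [set x in S]|.
  apply/subset_leq_card/subsetP => x; rewrite !inE => /andP[ux vx].
  by have := noX x; rewrite ux vx /= -negb_or negbK.
have cS : #|[set x in S]| <= size S by rewrite cardsE card_size.
have arith N0 R a b i p x w s' l h : p + i = a + b -> p <= N0 -> i <= x -> x <= w + s' ->
    s' <= l -> w <= 10 * h -> l <= 4 -> 2 <= h -> 2 * h <= R ->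
    N0 + 12 * R <= a.*2 + 1 -> N0 + 12 * R <= b.*2 + 1 -> False by clear; lia.
exact: arith (cardsUI (N u) (N v)) (max_card _) sub (leq_card_setU _ _) cS
  cW sS rm rrm (deg u) (deg v).
Qed.

(** Dirac's theorem as the case of no bowties. *)
Lemma hamilton_exists : exists2 c, perm_eq c (enum V) & cycle (adj G) c.
Proof.
have [u|c [_ [pc _ cc _ _]]] := bowties_hamilton (adj G) (fun _ _ => 0)
  (adj_sym G) (adj_irr G) (fun _ _ => erefl) [::] isT isT; last by exists c.
by rewrite count_degree muln0 addn0; move: (deg u) rm rrm; rewrite /n; clear; lia.
Qed.

Lemma sum_set (A : {set V}) c : perm_eq c (enum V) ->
  \sum_(x <- c) (x \in A : nat) = #|A|.
Proof.
move=> pc; rewrite (perm_big _ pc) /= big_enum /= -sum1_card [RHS]big_mkcond /=.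
by apply: eq_bigr => x _; case: (x \in A).
Qed.

(* On edges off [W] the structure gives [col u v = i] iff exactly one endpoint
   has label [i]; summing over a Hamilton cycle counts every vertex twice. *)
Lemma label_class_size (W : {set V}) k f i c :
    (forall u v, u \notin W -> v \notin W -> adj G u v ->
      (f u = k /\ col u v = f v) \/ (f v = k /\ col u v = f u)) ->
    {in W, forall x, f x = k} -> i != k -> perm_eq c (enum V) -> cycle (adj G) c ->
  cyclew (colw col i) c <= (#|[set x | f x == i]| + #|W|).*2 /\
  (#|[set x | f x == i]|).*2 <= cyclew (colw col i) c + (#|W|).*2.
Proof.
move=> st fW ik pc cc; set B := [set x | f x == i].
have BW x : x \in B -> x \in W = false.
  by rewrite inE => fx; apply: contraNF ik => /fW <-; rewrite eq_sym.
pose b x : nat := x \in B; pose w x : nat := x \in W.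
(* [b] vanishes on [W], whose labels are [k]; on an edge meeting [W], the term [w] pays for both
   inequalities. *)
have key x y : adj G x y ->
    colw col i x y <= (b x + w x) + (b y + w y) /\
    b x + b y <= colw col i x y + (w x + w y).
  move=> xy; rewrite /colw /b /w.
  have [xW|xW] := boolP (x \in W).
    have -> : x \in B = false by apply: contraTF xW => /BW->.
    by split; case: (y \in B) (y \in W) (col x y == i) => [] [] [].
  have [yW|yW] := boolP (y \in W).
    have -> : y \in B = false by apply: contraTF yW => /BW->.
    by split; case: (x \in B) (col x y == i) => [] [].
  rewrite !inE; case: (st x y xW yW xy) => -[-> ->];
  by rewrite (eq_sym k) (negbTE ik) ?addn0 ?add0n.
split.
  apply: leq_trans (cyclew_le _ _ _ _ (fun x y xy => (key x y xy).1) cc) _.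
  by rewrite (cyclew_vertex (fun x => b x + w x)) big_split /= !sum_set.
have := cyclew_le _ _ _ _ (fun x y xy => (key x y xy).2) cc.
by rewrite (cyclew_add (colw col i)) !cyclew_vertex !sum_set.
Qed.

Hypotheses (r3 : r <> 3) (large : 200 * (r ^ 2 * m) <= n).

Lemma labelling : exists k (f : V -> 'I_r) (W : {set V}),
  [/\ #|W| <= 10 * (r * m), {in W, forall x, f x = k} &
    forall u v, u \notin W -> v \notin W -> adj G u v ->
      (f u = k /\ col u v = f v) \/ (f v = k /\ col u v = f u)].
Proof.
have [W cW HW] := hitting_set.
have /card_gt0P[x0 _] : 0 < n by move: large rm rrm; clear; lia.
have [] := coloring_structure (adj G) col W (adj_sym G) (adj_irr G)
   (edge_colorC chi) (fun u v S => common_neighbour W u v S cW) HW x0.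
  (* Relabelling [W] by [k] leaves the edges off [W] untouched and keeps the other classes disjoint
     from [W]. *)
  case=> k [f st]; exists k, (fun x => if x \in W then k else f x), W; split=> //.
    by move=> x ->.
  by move=> u v uW vW /(st u v uW vW); rewrite (negbTE uW) (negbTE vW).
case=> p [q [t [pq pt qt st]]]; exfalso.
(* As r is not 3, some colour [l] is none of the three. It occurs only on edges meeting [W], at most
   2|W| <= 20rm times on a Hamilton cycle, too rarely for the bias bound. *)
have [l lS] : exists l, l \notin [:: p; q; t].
  apply/existsP; rewrite -negb_forall; apply/negP => /forallP H; apply: r3.
  have u3 : uniq [:: p; q; t] by rewrite /= !inE negb_or pq pt qt.
  have E : #|'I_r| = #|[:: p; q; t]| by apply: eq_card => x; rewrite H.
  by move: E; rewrite card_ord (card_uniqP u3).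
have [c pc cc] := hamilton_exists.
have [b1 _] := bias c l pc cc.
have : cyclew (colw col l) c <= (#|W|).*2.
  rewrite -(sum_set W c pc) -cyclew_vertex; apply: cyclew_le cc => x y xy.
  have [xW|xW] := boolP (x \in W); first by rewrite /colw; case: (_ == l).
  have [yW|yW] := boolP (y \in W); first by rewrite /colw; case: (_ == l).
  by rewrite /colw; case: eqP (st x y xW yW xy) => // ->; rewrite (negbTE lS).
move: b1 cW large m0 r2; rewrite /n; clear; nia.
Qed.

(** [t] depends on [k] because the special colour is found only in the proof. [Z] collects [W] and
    the vertices relabelled to reach the prescribed sizes. *)
Lemma sized_labelling (t : 'I_r -> 'I_r -> nat) :
    (forall k, \sum_i t k i = n) ->
    (forall k i, i != k ->
       2 * r * t k i <= n + 2 * r /\ n <= 2 * r * t k i + 2 * r) ->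
  exists k (f : V -> 'I_r) (Z : {set V}),
  [/\ #|Z| < 100 * r ^ 2 * m, forall i, #|[set x | f x == i]| = t k i &
    forall u v, u \notin Z -> v \notin Z -> adj G u v ->
      (f u = k /\ col u v = f v) \/ (f v = k /\ col u v = f u)].
Proof.
move=> tn tb; have [k [f [W [cW fW st]]]] := labelling.
have [f' [ft f'f]] := relabel_sizes V r (t k) f (tn k).
exists k, f', (W :|: [set x | f' x != f x]); split=> //; last first.
  move=> u v; rewrite !inE !negb_or !negbK => /andP[uW /eqP->] /andP[vW /eqP->].
  exact: st.
(* [D] bounds the sum of 10rm from [W], m/2 from the bias and 1 from rounding. *)
pose b i := #|[set x | f x == i]|; pose D := 13 * (r * m).
have [c pc cc] := hamilton_exists.
have bt i : i != k -> b i <= t k i + D /\ t k i <= b i + D.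
  move=> ik; have [] := label_class_size W k f i c st fW ik pc cc.
  have [] := bias c i pc cc; have [] := tb k i ik; rewrite -/(b i) /D.
  have arith B T x w : 2 * r * T <= n + 2 * r -> n <= 2 * r * T + 2 * r ->
      n < r * x + r * m -> r * x < n + r * m -> x <= (B + w).*2 ->
      B.*2 <= x + w.*2 -> w <= 10 * (r * m) ->
      B <= T + 13 * (r * m) /\ T <= B + 13 * (r * m).
    rewrite -!muln2 => h1 h2 h3 h4 h5 h6 h7.
    have : r * (B * 2) <= r * (x + w * 2) by rewrite leq_mul.
    have : r * x <= r * ((B + w) * 2) by rewrite leq_mul.
    have E1 : r * (B * 2) < r * (T * 2 + 2 + m + w * 2) -> B * 2 < T * 2 + 2 + m + w * 2.
      by rewrite ltn_mul2l => /andP[].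
    have E2 : r * (T * 2) < r * (B * 2 + 2 + m + w * 2) -> T * 2 < B * 2 + 2 + m + w * 2.
      by rewrite ltn_mul2l => /andP[].
    move: E1 E2 h1 h2 h3 h4 h7 mrm rm; rewrite !mulnDr; clear; lia.
  by move=> h1 h2 h3 h4 h5 h6; apply: arith h1 h2 h3 h4 h5 h6 cW.
have sb : \sum_i b i = n.
  rewrite -[n]sum1_card (partition_big f xpredT) //=.
  by apply: eq_bigr => i _; rewrite /b -sum1_card; apply: eq_bigl => x; rewrite inE.
have s1 : \sum_(i | i != k) (t k i - b i) <= (r.-1) * D.
  have -> : r.-1 * D = \sum_(i | i != k) D by rewrite sum_nat_const cardC1 card_ord.
  by apply: leq_sum => i /bt[_]; clear; lia.
have s2 : \sum_(i | i != k) b i <= \sum_(i | i != k) t k i + (r.-1) * D.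
  have -> : r.-1 * D = \sum_(i | i != k) D by rewrite sum_nat_const cardC1 card_ord.
  by rewrite -big_split; apply: leq_sum => i /bt[].
(* Class [k] lacks at most what the others have in excess, so the total deficit is at most 2(r -
   1)D. *)
have arith x y p q a d z w u : x + p = n -> y + q = n -> p <= q + d -> a <= d ->
    z <= (y - x) + a -> w <= 10 * (r * m) -> u <= w + z ->
    u <= 2 * d + 10 * (r * m) by clear; lia.
rewrite (bigD1 k) //= -/(b k) in f'f.
rewrite (bigD1 k) //= in sb; have tk := tn k; rewrite (bigD1 k) //= in tk.
apply: leq_ltn_trans (arith _ _ _ _ _ _ _ _ _ sb tk s2 s1 f'f cW (leq_card_setU _ _)) _.
by rewrite /D; move: r2 m0; clear; nia.
Qed.

End HamiltonBias.

(** * From rational bounds and labels to the partition *)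

Local Open Scope ring_scope.

Section FromHamiltonCycles.

Context {V : finType} {r : nat}.
Variables (G : sgraph V) (chi : {set V} -> 'I_r).

Lemma color_bias_count (m : nat) c i : (0 < r)%N -> (2 < #|V|)%N ->
    (forall H, hamilton_cycle G H -> color_bias G chi H < m%:R) ->
    perm_eq c (enum V) -> cycle (adj G) c ->
  (#|V| < r * cyclew (colw (edge_color chi) i) c + r * m)%N /\
  (r * cyclew (colw (edge_color chi) i) c < #|V| + r * m)%N.
Proof.
move=> r0 V2 bias pc cc; have uc : uniq c by rewrite (perm_uniq pc) enum_uniq.
have sc : (2 < size c)%N by rewrite (perm_size pc) -cardE.
have {}bias : color_bias G chi (cycle_edges c) < m%:R.
  apply: bias; exists c; split=> //; first by rewrite /ucycle cc uc.
  by move=> x; rewrite (perm_mem pc) mem_enum.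
rewrite -(color_count G) //; have := le_lt_trans (le_bigmax _ _ i) bias.
move: #|_ :&: _| => x; rewrite ltr_norml => /andP[lo hi].
have rR : (0 : rat) < r%:R by rewrite ltr0n.
rewrite -!(ltr_nat rat) !natrD !natrM -mulrDr; split.
  by rewrite mulrC -ltr_pdivrMr //; lra.
have -> : #|V|%:R + r%:R * m%:R = r%:R * (#|V|%:R / r%:R + m%:R) :> rat.
  by field; rewrite gt_eqF.
by rewrite ltr_pM2l //; lra.
Qed.

Lemma min_degree_count (m : nat) u :
    rounds_to (min_degree G) (#|V|%:R / 2%:R + 6%:R * r%:R ^+ 2 * m%:R) ->
  (#|V| + 12 * (r ^ 2 * m) <= (degree G u).*2 + 1)%N.
Proof.
move=> /rounds_to_gt H; have := min_degree_le G u; rewrite -(ler_nat rat) => le.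
rewrite -ltnS -(ltr_nat rat) -addn1 -muln2 !natrD !natrM.
move: le H; lra.
Qed.

Lemma edgesP (A : {set V}) : A \in edges G ->
  exists u v, A = [set u; v] /\ adj G u v.
Proof. by case/imset2P=> u v _; rewrite inE => /andP[_ uv] ->; exists u, v. Qed.

Lemma card_edge (A : {set V}) : A \in edges G -> #|A| = 2.
Proof.
case/edgesP=> u [v [-> uv]]; rewrite cards2.
by case: eqP uv => // ->; rewrite adj_irr.
Qed.

(** Off [Z] every edge has an end labelled [k] and the colour of its other label, which no offending
    edge does; offending edges therefore meet [Z]. When [#|V| < 2 * s], no matching is large enough
    anyway. *)
Lemma nearly_partition s k (f : V -> 'I_r) (Z : {set V}) :
    ((#|Z| < s) || (#|V| < 2 * s))%N ->
    (forall u v, u \notin Z -> v \notin Z -> adj G u v ->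
      (f u = k /\ edge_color chi u v = f v) \/ (f v = k /\ edge_color chi u v = f u)) ->
  let P i := [set x | f x == i] in
  [/\ nearly_mono G chi s k (induced_edges G (P k)),
      (forall i : 'I_r, i != k -> nearly_mono G chi s i (bipartite_edges G (P i) (P k)))
    & nearly_empty s (induced_edges G (\bigcup_(i < r | i != k) P i))].
Proof.
move=> size_Z st P.
have near (F : {set {set V}}) : F \subset edges G ->
    (forall u v, [set u; v] \in F -> adj G u v -> u \notin Z -> v \notin Z ->
      False) -> nearly_empty s F.
  move=> /subsetP FE FZ; case/orP: size_Z => [Zs|Vs]; last first.
    by apply: nearly_empty_large Vs => A /FE/card_edge.
  apply: nearly_empty_hit Zs _ => A AF; apply/negP => AZ.
  have [u [v [E uv]]] := edgesP _ (FE A AF); move: AF AZ; rewrite E => AF AZ.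
  by apply: FZ AF uv _ _; rewrite (disjointFr AZ) // !inE eqxx ?orbT.
have inP u v (A : {set V}) : [set u; v] \subset A -> u \in A /\ v \in A.
  by rewrite subUset !sub1set => /andP.
split=> [|i ik|].
- apply: near => [|u v].
    by apply/subsetP => A /setDP[]; rewrite inE => /andP[].
  rewrite !inE => /andP[nk /andP[E /inP[]]]; rewrite !inE => /eqP fu /eqP fv uv uZ vZ.
  move: nk; rewrite E /= -[chi _]/(edge_color chi u v).
  by case: (st u v uZ vZ uv) => -[_ ->]; rewrite ?fu ?fv eqxx.
- apply: near => [|u v].
    apply/subsetP => A /setDP[/imset2P[u v _]]; rewrite inE => /andP[_ uv] -> _.
    exact: adj_edges.
  rewrite !inE => /andP[nk /imset2P[x y]]; rewrite !inE => /eqP fx /andP[/eqP fy xy].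
  move=> E uv uZ vZ; move: nk; rewrite E adj_edges //= => nk.
  have nZ z : z \in [set x; y] -> z \notin Z by rewrite -E !inE => /orP[] /eqP->.
  have xZ : x \notin Z by rewrite nZ ?inE ?eqxx.
  have yZ : y \notin Z by rewrite nZ ?inE ?eqxx ?orbT.
  move: nk; rewrite -[chi _]/(edge_color chi x y).
  case: (st x y xZ yZ xy) => -[e1 ->]; last by rewrite fx eqxx.
  by move: ik; rewrite -fx e1 eqxx.
- apply: near => [|u v]; first by apply/subsetP => A; rewrite inE => /andP[].
  rewrite inE => /andP[_ /inP[/bigcupP[i ik]]]; rewrite inE => /eqP fu.
  case/bigcupP=> j jk; rewrite inE => /eqP fv uv uZ vZ.
  by case: (st u v uZ vZ uv) => -[fk _]; move: ik jk; rewrite -fu -fv fk eqxx.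
Qed.

End FromHamiltonCycles.

Theorem theorem1p2 (r : nat) (hr : (2 <= r)%N) (hr3 : r <> 3%N) :
  exists n0 : nat,
  forall (n m s : nat) (V : finType) (G : sgraph V) (chi : {set V} -> 'I_r),
  (n0 <= n)%N -> (0 < n)%N -> (0 < m)%N -> (0 < s)%N ->
  (m%:R : rat) < 2%:R ^- 6 * r%:R ^+ 2 * n%:R ->
  s = (100 * r ^ 2 * m)%N ->
  #|V| = n ->
  rounds_to (min_degree G) (n%:R / 2%:R + 6%:R * r%:R ^+ 2 * m%:R) ->
  (forall H : {set {set V}}, hamilton_cycle G H -> color_bias G chi H < m%:R) ->
  exists (k : 'I_r) (P : 'I_r -> {set V}),
    [/\ \bigcup_(i < r) P i = [set: V],
        (forall i j : 'I_r, i != j -> [disjoint P i & P j]),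
        rounds_to #|P k| ((r%:R + 1) / (2%:R * r%:R) * n%:R)
      & (forall i : 'I_r, i != k -> rounds_to #|P i| (n%:R / (2%:R * r%:R)))]
    /\
    [/\ nearly_mono G chi s k (induced_edges G (P k)),
        (forall i : 'I_r, i != k ->
           nearly_mono G chi s i (bipartite_edges G (P i) (P k)))
      & nearly_empty s (induced_edges G (\bigcup_(i < r | i != k) P i))].
Proof.
exists 0%N => n m s V G chi _ _ m0 _ _ sE Vn degG bias.
have [t tP] : exists t : 'I_r -> 'I_r -> nat, forall k, [/\ (\sum_i t k i = n)%N,
    rounds_to (t k k) ((r%:R + 1) / (2%:R * r%:R) * n%:R),
    (forall i, i != k -> rounds_to (t k i) (n%:R / (2%:R * r%:R)))
  & forall i, i != k -> (2 * r * t k i <= n + 2 * r /\ n <= 2 * r * t k i + 2 * r)%N].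
  exact: (fin_all_exists (fun k => part_sizes r n k hr)).
suff [k [f [Z [sZ ft st]]]] : exists k (f : V -> 'I_r) (Z : {set V}),
   [/\ (#|Z| < s) || (#|V| < 2 * s), forall i, #|[set x | f x == i]| = t k i &
    forall u v, u \notin Z -> v \notin Z -> adj G u v ->
      (f u = k /\ edge_color chi u v = f v) \/ (f v = k /\ edge_color chi u v = f u)]%N.
  exists k, (fun i => [set x | f x == i]); split; last exact: nearly_partition sZ st.
  have [_ tk ti _] := tP k; split=> [|i j ij||i ik].
  - by apply/setP => x; rewrite inE; apply/bigcupP; exists (f x); rewrite ?inE.
  - rewrite -setI_eq0; apply/eqP/setP => x; rewrite !inE.
    by apply: contraNF ij => /andP[/eqP <- /eqP <-].
  - by rewrite ft.
  - by rewrite ft ti.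
have tn k : (\sum_i t k i = #|V|)%N by rewrite Vn; have [] := tP k.
(* If n < 2s, no matching of size s exists and any partition of the right sizes will do. Otherwise
   2s <= n is the bound n >= 200r^2m required by [sized_labelling]. *)
have [large|small] := leqP (2 * s) n.
  have V2 : (2 < #|V|)%N by move: large m0 hr; rewrite sE Vn; clear; nia.
  rewrite -Vn in degG.
  have deg u := min_degree_count G m u degG.
  have biasE c i := color_bias_count G chi m c i (ltnW hr) V2 bias.
  have large' : (200 * (r ^ 2 * m) <= #|V|)%N by rewrite Vn -mulnA mulnA; lia.
  have tb k i : i != k ->
      (2 * r * t k i <= #|V| + 2 * r /\ #|V| <= 2 * r * t k i + 2 * r)%N.
    by rewrite Vn; have [_ _ _] := tP k; apply.
  have [k [f [Z [sZ ft st]]]] :=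
    sized_labelling G chi m hr m0 deg biasE hr3 large' t tn tb.
  by exists k, f, Z; split=> //; rewrite sE sZ.
pose k : 'I_r := Ordinal (ltnW hr).
have [f [ft _]] := relabel_sizes V r (t k) (fun _ => k) (tn k).
by exists k, f, [set: V]; split=> [|//|u v]; rewrite ?inE // Vn small orbT.
Qed.
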